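(* Let $a\ge 1$. If $a\equiv 0$ or $2\pmod 3$, rowmotion on the lower order ideals of the circular fence $\overline{F}(a,1,1,1)$ has a unique orbit, of size $3a+4$, and $\overline{\chi}$ is homomesic. If $a\equiv 1\pmod 3$, rowmotion has exactly $3$ orbits, of sizes $a+2$, $a+1$ and $a+1$, with $\overline{\chi}$ values $(a+2)(a+3)/2$, $(a+2)(a+3)/2$ and $a(a+3)/2$ respectively.
   Context: For a composition $\alpha=(\alpha_1,\ldots,\alpha_{2s})$ of $n$ (positive integers summing to $n$), the circular fence $\overline{F}(\alpha)$ is the poset on $x_1,\ldots,x_n$ (indices mod $n$) generated by $x_1\preceq\cdots\preceq x_{\alpha_1+1}\succeq\cdots\succeq x_{\alpha_1+\alpha_2+1}\preceq\cdots\succeq x_{n+1}=x_1$ (first $\alpha_1$ steps up, next $\alpha_2$ down, alternately). Rowmotion sends a lower order ideal $I$ to the lower ideal generated by the minimal elements of the complement of $I$. For an orbit $\mathcal{O}$, $\overline{\chi}(\mathcal{O})=\sum_{I\in\mathcal{O}}|I|$; $\overline{\chi}$ is homomesic if $\overline{\chi}(\mathcal{O})/|\mathcal{O}|$ is the same for all orbits. *)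

(* Defs.v *)
From mathcomp Require Export all_boot all_order all_algebra.

Set Implicit Arguments.
Unset Strict Implicit.
Unset Printing Implicit Defensive.

Import GRing.Theory.

Section Rowmotion.

Variables (T : finType) (le : rel T).

Definition lower_ideal (I : {set T}) : bool :=
  [forall y in I, forall x, le x y ==> (x \in I)].

Definition ideal_gen (A : {set T}) : {set T} :=
  [set x | [exists y in A, le x y]].

Definition minimal_elements (A : {set T}) : {set T} :=
  [set x in A | [forall y in A, le y x ==> (y == x)]].

Definition rowmotion (I : {set T}) : {set T} :=
  ideal_gen (minimal_elements (~: I)).

(* [rowmotion] is a total function on [{set T}], but only the orbits of lower
   ideals are collected; on these it is a permutation when [le] is a partial
   order, so forward iterates give the whole orbit. *)
Definition rowmotion_orbits : {set {set {set T}}} :=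
  [set [set J in fingraph.orbit rowmotion I] | I : {set T} & lower_ideal I].

Definition homomesic (st : {set {set T}} -> nat) : Prop :=
  forall O1 O2, O1 \in rowmotion_orbits -> O2 \in rowmotion_orbits ->
    ((st O1)%:R / #|O1|%:R = (st O2)%:R / #|O2|%:R :> rat)%R.

End Rowmotion.

Definition chibar (T : finType) (O : {set {set T}}) : nat :=
  \sum_(I in O) #|I|.

(* The ordinal [i] stands for x_(i+1). The step from [i] to its cyclic
   successor [ordS i] lies in the part of [alpha] of (0-based) index
   [reshape_index alpha i], and goes up iff that index is even. *)
Definition fence_step (alpha : seq nat) : rel 'I_(sumn alpha) :=
  fun x y => (y == ordS x) && ~~ odd (reshape_index alpha x)
          || (x == ordS y) && odd (reshape_index alpha y).

(* Intended for compositions, i.e. [alpha] of even size with positive parts. *)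
Definition circular_fence (alpha : seq nat) : rel 'I_(sumn alpha) :=
  connect (@fence_step alpha).

(* Main.v *)
Require Import Defs.
From mathcomp Require Import all_boot all_order all_algebra.
From mathcomp Require Import zify.

(** In F(a,1,1,1) the elements 0 < 1 < ... < a form a chain, and the two others
    are a minimal element a+1, below a and a+2, and a maximal element a+2, above
    0 and a+1. A lower ideal is thus a pair (t, k): it contains the k smallest
    chain elements and the first t of a+1, a+2. Rowmotion sends (t, k) to
    (t+1 mod 3, k+1), except that it sends (1, 0) to (0, 1) and, at the end of
    the chain, (0, a) to (1, 0), (1, a) through (2, a+1) to (0, 0), and (2, a)
    through (1, a+1) to (2, 1). So the ideals are spread over three strands,
    starting at (0, 0), (1, 0) and (2, 1), and a mod 3 decides which strand
    follows which: if a = 1 mod 3 each strand closes up on itself, otherwise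
    the three strands form one cycle. *)

(** * States, and rowmotion written on them *)

Definition fence_le (a x y : nat) : bool :=
  [|| x <= y <= a, x == y, (x == a.+1) && ((y == a) || (y == a.+2))
    | (x == 0) && (y == a.+2)].

Definition ideal_mem (a : nat) (c : nat * nat) (i : nat) : bool :=
  [|| i < minn c.2 a.+1, (i == a.+1) && (1 <= c.1) | (i == a.+2) && (2 <= c.1)].

Definition ideal_of (a : nat) (c : nat * nat) : {set 'I_(sumn [:: a; 1; 1; 1])} :=
  [set x : 'I_(sumn [:: a; 1; 1; 1]) | ideal_mem a c x].

(** Because [a] lies above [a.+1], the whole chain needs t > 0; because [a.+2] lies above 0, t = 2
    needs k > 0. *)
Definition valid (a : nat) (c : nat * nat) : bool :=
  [&& c.1 <= 2, c.2 <= a.+1, (c.1 == 0) ==> (c.2 <= a) & (c.1 == 2) ==> (0 < c.2)].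

Definition move (a : nat) (c : nat * nat) : nat * nat :=
  let: (t, k) := c in
  match t with
  | 0 => if k < a then (1, k.+1) else (1, 0)
  | 1 => if k == 0 then (0, 1) else if k == a.+1 then (2, 1) else (2, k.+1)
  | _ => if k == a.+1 then (0, 0) else if k == a then (1, a.+1) else (0, k.+1)
  end.

(** * The order of the fence in closed form *)

Lemma sumn_fence (a : nat) : sumn [:: a; 1; 1; 1] = a.+3.
Proof. by rewrite /= !addnS addn0. Qed.

Lemma fence_ord_exists {a i : nat} : i < a.+3 ->
  exists x : 'I_(sumn [:: a; 1; 1; 1]), nat_of_ord x = i.
Proof. by rewrite -(sumn_fence a) => hi; exists (Ordinal hi). Qed.

Lemma fence_ord_lt {a : nat} (x : 'I_(sumn [:: a; 1; 1; 1])) : nat_of_ord x < a.+3.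
Proof. by apply: leq_trans (ltn_ord x) _; rewrite sumn_fence. Qed.

Lemma odd_reshape_index (a i : nat) : i < a.+3 ->
  odd (reshape_index [:: a; 1; 1; 1] i) = (i == a) || (i == a.+2).
Proof.
move=> hi; rewrite /reshape_index /=.
by do 4 (case: ifP => ? /=; first lia); lia.
Qed.

Lemma val_ordS (a : nat) (x : 'I_(sumn [:: a; 1; 1; 1])) :
  nat_of_ord (ordS x) = if nat_of_ord x == a.+2 then 0 else (nat_of_ord x).+1.
Proof.
have hx := fence_ord_lt x.
rewrite -[LHS]/((nat_of_ord x).+1 %% sumn [:: a; 1; 1; 1]).
move: (nat_of_ord x) hx => i hi; rewrite sumn_fence.
case: eqP => [->|h]; first by rewrite modnn.
by rewrite modn_small //; lia.
Qed.

Lemma fence_stepE (a : nat) (x y : 'I_(sumn [:: a; 1; 1; 1])) :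
  @fence_step [:: a; 1; 1; 1] x y =
  [|| (nat_of_ord y == (nat_of_ord x).+1) && (y <= a),
      (nat_of_ord x == a.+1) && ((nat_of_ord y == a) || (nat_of_ord y == a.+2))
    | (nat_of_ord x == 0) && (nat_of_ord y == a.+2)].
Proof.
have hx := fence_ord_lt x.
have hy := fence_ord_lt y.
rewrite /fence_step !odd_reshape_index // -!(inj_eq (@ord_inj _)) !val_ordS.
move: (nat_of_ord x) (nat_of_ord y) hx hy => {x y} x y hx hy.
by case: ifP => ?; case: ifP => ?; lia.
Qed.

(** The explicit relation is reflexive and still holds after prefixing a fence step, so it contains
    all paths. Conversely only the relations inside the chain need several steps, and these follow
    by induction on the distance; the other strict relations are single steps. *)
Lemma circular_fenceE (a : nat) : 0 < a -> forall x y : 'I_(sumn [:: a; 1; 1; 1]),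
  @circular_fence [:: a; 1; 1; 1] x y = fence_le a x y.
Proof.
move=> ha x y; apply/idP/idP.
  case/connectP=> p; elim: p x => [|z p IH] x /=.
    by move=> _ ->; rewrite /fence_le eqxx !orbT.
  rewrite fence_stepE => /andP[hxz hp] hy; move: (IH z hp hy) hxz.
  rewrite /fence_le.
  have hx := fence_ord_lt x.
  have hz := fence_ord_lt z.
  by move: (nat_of_ord x) (nat_of_ord y) (nat_of_ord z) hx hz => *; lia.
have up n (u v : 'I_(sumn [:: a; 1; 1; 1])) :
    nat_of_ord v = nat_of_ord u + n -> v <= a -> @circular_fence [:: a; 1; 1; 1] u v.
  elim: n v => [|n IH] v hv hva.
    by rewrite (_ : u = v) ?/circular_fence ?connect0 //; apply: ord_inj; rewrite hv addn0.
  have [w hw] : exists w : 'I_(sumn [:: a; 1; 1; 1]), nat_of_ord w = nat_of_ord u + n.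
    by apply: fence_ord_exists; move: (nat_of_ord u) (nat_of_ord v) hv hva => *; lia.
  have huw : @circular_fence [:: a; 1; 1; 1] u w.
    by apply: IH => //; move: (nat_of_ord u) (nat_of_ord v) (nat_of_ord w) hv hva hw => *; lia.
  apply: connect_trans huw _; apply: connect1; rewrite fence_stepE.
  by move: (nat_of_ord u) (nat_of_ord v) (nat_of_ord w) hv hva hw => *; lia.
case/or4P => [/andP[h1 h2]|/eqP/ord_inj ->|h|h].
- by apply: (up (y - x)); rewrite // subnKC.
- exact: connect0.
- by apply: connect1; rewrite fence_stepE h orbT.
- by apply: connect1; rewrite fence_stepE h !orbT.
Qed.

(** * Lower ideals as states, and the action of rowmotion *)

Lemma mem_ideal_of (a : nat) (c : nat * nat) (x : 'I_(sumn [:: a; 1; 1; 1])) :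
  (x \in ideal_of a c) = ideal_mem a c x.
Proof. by rewrite inE. Qed.

(** The first missing chain element is minimal outside the ideal unless it is [a] with [a.+1]
    missing below it; [a.+2] is minimal only once both elements that it covers, [a.+1] and 0, are in
    the ideal. *)
Definition min_mem (a : nat) (c : nat * nat) (i : nat) : bool :=
  [|| (i == c.2) && ((i < a) || (i == a) && (0 < c.1)), (i == a.+1) && (c.1 == 0)
    | [&& i == a.+2, c.1 == 1 & 0 < c.2]].

Lemma minimal_elements_ideal_of (a : nat) (c : nat * nat) : 0 < a -> valid a c ->
  minimal_elements (@circular_fence [:: a; 1; 1; 1]) (~: ideal_of a c)
  = [set x : 'I_(sumn [:: a; 1; 1; 1]) | min_mem a c x].
Proof.
case: c => t k ha; rewrite /valid /= => hv; apply/setP => x; rewrite !inE.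
have hx := fence_ord_lt x.
apply/andP/idP.
  case=> hxI /forallP hmin.
  have hm i : i < a.+3 -> ~~ ideal_mem a (t, k) i -> fence_le a i x -> i = x.
    move/fence_ord_exists=> [y <-] h1 h2.
    move: (hmin y); rewrite in_setC mem_ideal_of h1 circular_fenceE // h2 /=.
    by move=> /eqP ->.
  (* Minimality of [x] is tested against three elements only, [k], [a.+1] and 0; this already
     excludes everything that [min_mem] excludes. *)
  have hk : k <= x <= a -> x = k :> nat.
    move=> h; apply/esym/hm; [lia | rewrite /ideal_mem /=; lia | by rewrite /fence_le h].
  have hb : t = 0 -> (nat_of_ord x == a) || (nat_of_ord x == a.+2) -> a.+1 = x.
    by move=> t0 h; apply: hm; rewrite ?/ideal_mem ?/fence_le ?t0 ?h ?eqxx ?orbT //=; lia.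
  have h0 : k = 0 -> nat_of_ord x = a.+2 -> 0 = x.
    by move=> k0 h; apply: hm; rewrite ?/ideal_mem ?/fence_le ?k0 ?h ?eqxx ?orbT //=; lia.
  move: hxI hk hb h0; rewrite /ideal_mem /min_mem /=.
  move: (nat_of_ord x) hx => {hm hmin}x hx hxI hk hb h0.
  have [hxa|hxa] := leqP x a.
    have kx : k <= x by clear -hxI hxa; lia.
    have ek : x = k by apply: hk; rewrite kx.
    have [xa|xa] := eqVneq x a; last by rewrite -ek eqxx ltn_neqAle xa hxa.
    have : t <> 0 by move=> t0; have := hb t0; rewrite xa eqxx; clear; lia.
    by rewrite -ek xa eqxx ltnn /= lt0n => /eqP ->.
  have [xa|xa] := eqVneq x a.+1.
    have t0 : t == 0 by clear -hxI xa; lia.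
    by rewrite t0 orbT.
  have xa2 : x = a.+2 by clear -hx hxa xa; lia.
  have t1 : t <> 0 by move=> t0; have := hb t0; rewrite xa2 eqxx orbT; clear; lia.
  have k1 : k <> 0 by move=> k0; have := h0 k0 xa2; rewrite xa2.
  by clear -hxI hv xa2 t1 k1; lia.
move=> hmx; split.
  by move: hmx; rewrite /min_mem /ideal_mem /=; move: (nat_of_ord x) hx => *; lia.
apply/forallP => y; apply/implyP; rewrite !inE => hyI; apply/implyP.
rewrite circular_fenceE // -(inj_eq (@ord_inj _)).
have hy := fence_ord_lt y.
move: hmx hyI; rewrite /min_mem /ideal_mem /fence_le /=.
by move: (nat_of_ord x) (nat_of_ord y) hx hy => *; lia.
Qed.

Lemma rowmotion_ideal_of (a : nat) (c : nat * nat) : 0 < a -> valid a c ->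
  rowmotion (@circular_fence [:: a; 1; 1; 1]) (ideal_of a c) = ideal_of a (move a c).
Proof.
move=> ha hv; rewrite /rowmotion minimal_elements_ideal_of //.
apply/setP => x; rewrite !inE.
have hx := fence_ord_lt x.
(* Only [k], [a.+1] and [a.+2] can be minimal outside the ideal, so the generated ideal is a union
   of at most three principal ones. *)
have -> : [exists y in [set x0 : 'I_(sumn [:: a; 1; 1; 1]) | min_mem a c x0],
             @circular_fence [:: a; 1; 1; 1] x y]
   = [|| min_mem a c c.2 && fence_le a x c.2, min_mem a c a.+1 && fence_le a x a.+1
       | min_mem a c a.+2 && fence_le a x a.+2].
  apply/existsP/idP.
    case=> y; rewrite inE circular_fenceE // => /andP[hy hxy].
    have : [|| nat_of_ord y == c.2, nat_of_ord y == a.+1 | nat_of_ord y == a.+2].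
      by move: hy; rewrite /min_mem; move: (nat_of_ord y) => *; lia.
    by case/or3P => /eqP <-; rewrite hy hxy ?orbT.
  have ex i : i < a.+3 -> min_mem a c i && fence_le a x i ->
    exists y, (y \in [set x0 : 'I_(sumn [:: a; 1; 1; 1]) | min_mem a c x0])
              && @circular_fence [:: a; 1; 1; 1] x y.
    move/fence_ord_exists=> [y <-] h.
    by exists y; rewrite inE circular_fenceE.
  case/or3P; apply: ex => //.
  by move: hv; rewrite /valid; lia.
move: (nat_of_ord x) hx => {}x hx.
case: c hv => t k; rewrite /valid /= => hv.
have ht : [|| t == 0, t == 1 | t == 2] by lia.
case/or3P: ht hv => /eqP -> /= hv; rewrite /min_mem /fence_le /=.
- by case: ifP => h; rewrite /ideal_mem /=; lia.
- by case: ifP => h; last case: ifP => h'; rewrite /ideal_mem /=; lia.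
- by case: ifP => h; last case: ifP => h'; rewrite /ideal_mem /=; lia.
Qed.

Lemma lower_ideal_of (a : nat) (c : nat * nat) : 0 < a -> valid a c ->
  lower_ideal (@circular_fence [:: a; 1; 1; 1]) (ideal_of a c).
Proof.
move=> ha hv; apply/forallP => y; apply/implyP; rewrite mem_ideal_of => hy.
apply/forallP => x; apply/implyP; rewrite circular_fenceE // mem_ideal_of.
have hx := fence_ord_lt x.
move: hv hy; rewrite /valid /ideal_mem /fence_le.
by move: (nat_of_ord x) (nat_of_ord y) hx => *; lia.
Qed.

Lemma lower_idealP (a : nat) (I : {set 'I_(sumn [:: a; 1; 1; 1])}) : 0 < a ->
  lower_ideal (@circular_fence [:: a; 1; 1; 1]) I ->
  exists2 c, valid a c & I = ideal_of a c.
Proof.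
move=> ha /forallP hI.
pose m i := [exists x in I, nat_of_ord x == i].
have mE (x : 'I_(sumn [:: a; 1; 1; 1])) : (x \in I) = m (nat_of_ord x).
  apply/idP/existsP => [h|[y /andP[hy /eqP/ord_inj <-]] //].
  by exists x; rewrite h eqxx.
have down i j : fence_le a i j -> i < a.+3 -> m j -> m i.
  move=> hij hi /existsP[y /andP[hy /eqP hyj]].
  have [x hx] := fence_ord_exists hi.
  move: (hI y); rewrite hy /= => /forallP /(_ x).
  by rewrite circular_fenceE // hx hyj hij /= mE hx.
(* The disjunct [a < i] caps the search, so that [k] is [a.+1] when the whole chain lies in [I]. *)
have exk : exists i, (a < i) || ~~ m i by exists a.+1; rewrite ltnSn.
have [k hk kmin] := ex_minnP exk.
have hka : k <= a.+1 by apply: kmin; rewrite ltnSn.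
have mk i : i < k -> m i.
  by move=> hik; apply: contraLR hik => hm; rewrite -leqNgt kmin // hm orbT.
have mk' i : i <= a -> m i = (i < k).
  move=> hi; apply/idP/idP => [hm|]; last exact: mk.
  rewrite ltnNge; apply/negP => hki; move: hk; rewrite ltnNge (leq_trans hki hi) /=.
  by rewrite (down k i) //; rewrite /fence_le; lia.
have h1 := down a.+1 a; have h2 := down a.+1 a.+2; have h3 := down 0 a.+2.
have e0 := mk' 0; have ea := mk' a.
(* An ideal containing [a.+2] contains [a.+1], so counting how many of the two are present tells
   which ones are. *)
exists (m a.+1 + m a.+2, k).
  by move: h1 h2 h3 e0 ea; rewrite /valid /fence_le /=; clear -hka ha; lia.
apply/setP => x; rewrite mem_ideal_of mE.
have hx := fence_ord_lt x.
have hxk := mk' (nat_of_ord x).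
case: (leqP (nat_of_ord x) a) => hxa.
  by rewrite hxk // /ideal_mem /=; move: (nat_of_ord x) hxa => i hi; clear -hi; lia.
have {hxa} : (nat_of_ord x == a.+1) || (nat_of_ord x == a.+2).
  by move: (nat_of_ord x) hx hxa => i hi hxa; clear -hi hxa; lia.
move: h1 h2 h3; rewrite /ideal_mem /fence_le /=; clear -hka.
by move=> h1 h2 h3 /orP[] /eqP ->; lia.
Qed.

Lemma ideal_of_inj (a : nat) : {in valid a &, injective (ideal_of a)}.
Proof.
move=> [t k] [t' k']; rewrite /valid !unfold_in /= => h h' e.
have me i : i < a.+3 -> ideal_mem a (t, k) i = ideal_mem a (t', k') i.
  by move/fence_ord_exists=> [x <-]; rewrite -!mem_ideal_of e.
have et : t = t'.
  have h1 := me a.+1; have h2 := me a.+2; clear me e.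
  by move: h1 h2; rewrite /ideal_mem /= => *; lia.
subst t'; congr pair.
(* The smaller of [k] and [k'], taken as an element of the chain, lies in exactly one of the two
   ideals. *)
by case: (ltngtP k k') => // hk; [have := me k | have := me k'];
  rewrite /ideal_mem /=; clear -hk h h'; lia.
Qed.

Lemma card_ideal_of (a : nat) (c : nat * nat) : valid a c -> #|ideal_of a c| = c.1 + c.2.
Proof.
case: c => t k; rewrite /valid /= => hv.
rewrite -sum1_card.
rewrite (eq_bigl (fun x : 'I_(sumn [:: a; 1; 1; 1]) => ideal_mem a (t, k) x)); last first.
  by move=> x; rewrite mem_ideal_of.
rewrite -(big_mkord (ideal_mem a (t, k)) (fun=> 1)) sumn_fence big_mkcond.
have sum_lt n : \sum_(0 <= i < n) (if i < k then 1 else 0) = minn n k.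
  elim: n => [|n IH]; first by rewrite big_geq // min0n.
  by rewrite big_nat_recr //= IH; case: ifP => ?; lia.
rewrite big_nat_recr //= big_nat_recr //=.
rewrite (eq_big_nat _ _ (F2 := fun i => if i < k then 1 else 0)); last first.
  by move=> i hi; rewrite /ideal_mem /=; congr (if _ then _ else _); lia.
by rewrite sum_lt /ideal_mem /=; case: ifP => ?; case: ifP => ?; lia.
Qed.

(** * Iterating [move]: the three strands *)

Lemma move_valid (a : nat) (c : nat * nat) : 0 < a -> valid a c -> valid a (move a c).
Proof.
case: c => [[|[|t]] k] ha; rewrite /valid /= => hv.
- by case: ifP => ? /=; lia.
- by case: ifP => ? /=; [lia | case: ifP => ? /=; lia].
- by case: ifP => ? /=; [lia | case: ifP => ? /=; lia].
Qed.

(** As long as k < a, the state (1, 0) is the only one where [move] does not add one to both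
    entries, the first taken mod 3. Later iterates have a positive second entry and so never meet
    it. *)
Lemma iter_move (a t k j : nat) : t < 3 -> (t, k) != (1, 0) -> k + j <= a ->
  iter j (move a) (t, k) = ((t + j) %% 3, k + j).
Proof.
move=> ht hn; elim: j => [|j IH] hj; first by rewrite !addn0 modn_small.
rewrite iterS IH; last by lia.
have hk : (1 < (t + j) %% 3 + (k + j)) || ((t + j) %% 3 == 0) || ((t + j) %% 3 == 2).
  by move: hn; rewrite xpair_eqE => hn; case: j {IH} hj => *; lia.
have e : (t + j.+1) %% 3 = ((t + j) %% 3).+1 %% 3 by lia.
have hr : (t + j) %% 3 < 3 by lia.
rewrite e addnS; move: hk hr; case: ((t + j) %% 3) => [|[|[|r]]] //= hk _.
- by case: ifP => //; lia.
- by case: ifP => ?; [lia|case: ifP => //; lia].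
- by case: ifP => ?; [lia|case: ifP => //; lia].
Qed.

Lemma iter_move00 {a j : nat} : j <= a -> iter j (move a) (0, 0) = (j %% 3, j).
Proof. by move=> h; rewrite iter_move. Qed.

Lemma iter_move10 {a j : nat} : j < a -> iter j.+1 (move a) (1, 0) = (j %% 3, j.+1).
Proof. by move=> h; rewrite iterSr /= iter_move. Qed.

Lemma iter_move21 {a j : nat} : j < a -> iter j (move a) (2, 1) = ((2 + j) %% 3, j.+1).
Proof. by move=> h; rewrite iter_move. Qed.

Lemma move_top {a : nat} : 0 < a ->
  [/\ move a (0, a) = (1, 0), move a (1, a) = (2, a.+1), move a (2, a.+1) = (0, 0),
      move a (2, a) = (1, a.+1) & move a (1, a.+1) = (2, 1)].
Proof.
case: a => // a _.
by split; rewrite /= ?ltnn ?eqxx // ?eqSS ?(ltn_eqF (ltnSn _)).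
Qed.

(* A strand has one more entry, (2, a.+1) or (1, a.+1), unless it reaches (0, a). *)
Definition strand0 (a : nat) := traject (move a) (0, 0) (a.+1 + (a %% 3 != 0)).
Definition strand1 (a : nat) := traject (move a) (1, 0) (a.+1 + (a %% 3 != 1)).
Definition strand2 (a : nat) := traject (move a) (2, 1) (a + (a %% 3 != 2)).

(** The strand reaches k = a with first entry a mod 3. From there [move_top] leads to the start of a
    strand, in one step from (0, a) and in two from (1, a) or (2, a). The other two strands behave
    alike, with first entry a - 1 and a + 1 mod 3 at k = a. *)
Lemma iter_strand0 {a : nat} : 0 < a ->
  iter (a.+1 + (a %% 3 != 0)) (move a) (0, 0) =
  nth (0, 0) [:: (1, 0); (0, 0); (2, 1)] (a %% 3).
Proof.
move=> ha; have [e1 e2 e3 e4 e5] := move_top ha.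
have h : a %% 3 < 3 by rewrite ltn_mod.
have := iter_move00 (leqnn a).
case: (a %% 3) h => [|[|[|r]]] // _ /= e; rewrite ?addn0 ?addn1 /= e.
- by rewrite e1.
- by rewrite e2 e3.
- by rewrite e4 e5.
Qed.

Lemma iter_strand1 {a : nat} : 0 < a ->
  iter (a.+1 + (a %% 3 != 1)) (move a) (1, 0) =
  nth (0, 0) [:: (2, 1); (1, 0); (0, 0)] (a %% 3).
Proof.
case: a => // b ha; have [e1 e2 e3 e4 e5] := move_top ha.
have h : b %% 3 < 3 by rewrite ltn_mod.
have hb : b.+1 %% 3 = (b %% 3).+1 %% 3 by lia.
have := iter_move10 (ltnSn b); rewrite hb.
case: (b %% 3) h => [|[|[|r]]] // _ /= e; rewrite ?addn0 ?addn1 /= e.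
- by rewrite e1.
- by rewrite e2 e3.
- by rewrite e4 e5.
Qed.

Lemma iter_strand2 {a : nat} : 0 < a ->
  iter (a + (a %% 3 != 2)) (move a) (2, 1) =
  nth (0, 0) [:: (0, 0); (2, 1); (1, 0)] (a %% 3).
Proof.
case: a => // b ha; have [e1 e2 e3 e4 e5] := move_top ha.
have h : b %% 3 < 3 by rewrite ltn_mod.
have hb : b.+1 %% 3 = (b %% 3).+1 %% 3 by lia.
have hb' : (2 + b) %% 3 = (2 + (b %% 3)) %% 3 by lia.
have := iter_move21 (ltnSn b); rewrite hb hb'.
case: (b %% 3) h => [|[|[|r]]] // _ /= e; rewrite ?addn0 ?addn1 /= e.
- by rewrite e4 e5.
- by rewrite e1.
- by rewrite e2 e3.
Qed.

(** While k <= a, the residue of k - t mod 3 is constant along a strand, apart from the start (1,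
    0): it is 0, 1, 2 on [strand0], [strand1], [strand2]. It is written [k + 2 * t] to avoid
    subtraction. *)
Lemma valid_in_strands (a : nat) (c : nat * nat) : 0 < a -> valid a c ->
  [|| c \in strand0 a, c \in strand1 a | c \in strand2 a].
Proof.
case: c => t k ha; rewrite /valid /= => hv.
have [_ e2 _ e4 _] := move_top ha.
have in0 j : j < a.+1 + (a %% 3 != 0) -> iter j (move a) (0, 0) = (t, k) ->
    [|| (t, k) \in strand0 a, (t, k) \in strand1 a | (t, k) \in strand2 a].
  by move=> hj e; rewrite (_ : _ \in strand0 a) //; apply/trajectP; exists j.
have in1 j : j < a.+1 + (a %% 3 != 1) -> iter j (move a) (1, 0) = (t, k) ->
    [|| (t, k) \in strand0 a, (t, k) \in strand1 a | (t, k) \in strand2 a].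
  by move=> hj e; rewrite (_ : _ \in strand1 a) ?orbT //; apply/trajectP; exists j.
have in2 j : j < a + (a %% 3 != 2) -> iter j (move a) (2, 1) = (t, k) ->
    [|| (t, k) \in strand0 a, (t, k) \in strand1 a | (t, k) \in strand2 a].
  by move=> hj e; rewrite (_ : _ \in strand2 a) ?orbT //; apply/trajectP; exists j.
have [h10|h10] := eqVneq (t, k) (1, 0); first by apply: (in1 0).
rewrite xpair_eqE in h10.
have [hka|hka] := leqP k a.
  have [r0|r0] := boolP ((k + 2 * t) %% 3 == 0).
    by apply: (in0 k); [lia | rewrite iter_move00 //; congr pair; lia].
  have hk : 0 < k by lia.
  case: k hk {in0} hv h10 hka r0 in1 in2 => // k _ hv h10 hka r0 in1 in2.
  have [r1|r1] := boolP ((k.+1 + 2 * t) %% 3 == 1).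
    by apply: (in1 k.+1); [lia | rewrite iter_move10 //; congr pair; lia].
  by apply: (in2 k); [lia | rewrite iter_move21 //; congr pair; lia].
have ek : k = a.+1 by lia.
have ht : (t == 1) || (t == 2) by lia.
case: a ha hka ek e2 e4 hv in0 in1 in2 => // b _ _ -> e2 e4 hv in0 in1 in2.
(* The state (1, a+1) is the image of (2, a), and (2, a+1) that of (1, a); the residue of [b], where
   a = b + 1, says which strand passes there. *)
have : [|| b %% 3 == 0, b %% 3 == 1 | b %% 3 == 2] by lia.
case/orP: ht in0 in1 in2 => /eqP -> in0 in1 in2 /or3P[] /eqP hb.
- apply: (in2 b.+1); first by lia.
  by rewrite iterS iter_move21 // -[RHS]e4; congr (move _ (_, _)); lia.
- apply: (in0 b.+2); first by lia.
  by rewrite iterS iter_move00 // -[RHS]e4; congr (move _ (_, _)); lia.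
- apply: (in1 b.+2); first by lia.
  by rewrite iterS iter_move10 // -[RHS]e4; congr (move _ (_, _)); lia.
- apply: (in0 b.+2); first by lia.
  by rewrite iterS iter_move00 // -[RHS]e2; congr (move _ (_, _)); lia.
- apply: (in1 b.+2); first by lia.
  by rewrite iterS iter_move10 // -[RHS]e2; congr (move _ (_, _)); lia.
- apply: (in2 b.+1); first by lia.
  by rewrite iterS iter_move21 // -[RHS]e2; congr (move _ (_, _)); lia.
Qed.

Lemma size_strands (a : nat) : size (strand0 a ++ strand1 a ++ strand2 a) = 3 * a + 4.
Proof. by rewrite !size_cat !size_traject; lia. Qed.

(* There are as many states as entries in the three strands, and each state occurs. *)
Lemma uniq_strands {a : nat} : 0 < a -> uniq (strand0 a ++ strand1 a ++ strand2 a).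
Proof.
move=> ha.
pose s := [seq (0, k) | k <- iota 0 a.+1] ++ [seq (1, k) | k <- iota 0 a.+2]
          ++ [seq (2, k) | k <- iota 1 a.+1].
apply: (@leq_size_uniq _ s).
- rewrite !cat_uniq !map_inj_uniq ?iota_uniq; try by move=> ? ? [].
  apply/and3P; split=> //; last (apply/and3P; split=> //).
    by apply/hasPn => c; rewrite mem_cat => /orP[] /mapP[k _ ->]; apply/mapP => -[].
  by apply/hasPn => c /mapP[k _ ->]; apply/mapP => -[].
- move=> c hc; rewrite !mem_cat; apply: valid_in_strands => //.
  move: hc; rewrite !mem_cat => /or3P[] /mapP[k]; rewrite mem_iota => hk ->;
  by rewrite /valid /=; lia.
- by rewrite size_strands !size_cat !size_map !size_iota; lia.
Qed.

(** * From cycles of states to orbits of ideals, their sizes and sums *)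

Lemma fcycle_traject {T : eqType} {f : T -> T} {x : T} {n : nat} :
  iter n f x = x -> fcycle f (traject f x n).
Proof.
case: n => // n e /=.
have -> : rcons (traject f (f x) n) x = traject f (f x) n.+1 by rewrite trajectSr -iterSr e.
exact: fpath_traject.
Qed.

Lemma all_valid_traject {a : nat} {c : nat * nat} (n : nat) :
  0 < a -> valid a c -> all (valid a) (traject (move a) c n).
Proof.
move=> ha; elim: n c => //= n IH c hc.
by rewrite hc IH // move_valid.
Qed.

(** On valid states [ideal_of] intertwines [move] with [rowmotion], so it sends a cycle to a cycle,
    and the orbit of any point of a cycle is the whole cycle. *)
Lemma rowmotion_orbit_traject (a : nat) (c d : nat * nat) (n : nat) :
  0 < a -> valid a c -> iter n (move a) c = c -> d \in traject (move a) c n ->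
  [set J in fingraph.orbit (rowmotion (@circular_fence [:: a; 1; 1; 1])) (ideal_of a d)]
  = [set J in map (ideal_of a) (traject (move a) c n)].
Proof.
move=> ha hc e hd; apply/setP => J; rewrite !inE -fconnect_orbit.
apply: fconnect_cycle; last exact: map_f.
apply: (@homo_cycle_in _ _ (valid a)) (all_valid_traject n ha hc) (fcycle_traject e).
by move=> x y hx _ /eqP <- /=; rewrite rowmotion_ideal_of.
Qed.

Lemma card_ideals (a : nat) (s : seq (nat * nat)) : uniq s -> all (valid a) s ->
  #|[set J in map (ideal_of a) s]| = size s.
Proof.
move=> hu hs; rewrite cardsE -(size_map (ideal_of a)); apply/card_uniqP.
rewrite map_inj_in_uniq // => x y hx hy.
by apply: ideal_of_inj; rewrite unfold_in; apply: (allP hs).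
Qed.

Lemma chibar_ideals (a : nat) (s : seq (nat * nat)) : uniq s -> all (valid a) s ->
  chibar [set J in map (ideal_of a) s] = \sum_(c <- s) (c.1 + c.2).
Proof.
move=> hu hs; rewrite /chibar (eq_bigl (mem (map (ideal_of a) s))); last by move=> J; rewrite inE.
rewrite -big_uniq ?big_map; last first.
  rewrite map_inj_in_uniq // => x y hx hy.
  by apply: ideal_of_inj; rewrite unfold_in; apply: (allP hs).
by apply: eq_big_seq => c hc; rewrite card_ideal_of //; apply: (allP hs).
Qed.

Lemma big_traject (T : Type) (f : T -> T) (F : T -> nat) (x : T) (n : nat) :
  \sum_(y <- traject f x n) F y = \sum_(i < n) F (iter i f x).
Proof.
elim: n => [|n IH]; first by rewrite big_nil big_ord0.
by rewrite trajectSr big_rcons IH big_ord_recr.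
Qed.

(** Three consecutive residues sum to 3 whatever the shift [d] is, so the residues contribute 3m in
    total. Doubling avoids division in [nat]. *)
Lemma sum_residues (d m : nat) :
  (\sum_(i < 3 * m) ((d + i) %% 3 + i)) * 2 = 3 * m * (3 * m + 1).
Proof.
elim: m => [|m IH]; first by rewrite big_ord0.
have -> : 3 * m.+1 = (3 * m).+3 by lia.
rewrite !big_ord_recr /= !mulnDl IH.
by lia.
Qed.

Lemma lower_ideal_orbit (a : nat) (c : nat * nat) : 0 < a -> valid a c ->
  [set J in fingraph.orbit (rowmotion (@circular_fence [:: a; 1; 1; 1])) (ideal_of a c)]
  \in rowmotion_orbits (@circular_fence [:: a; 1; 1; 1]).
Proof. by move=> ha hc; apply: imset_f; rewrite inE lower_ideal_of. Qed.

(** A closed trajectory through all states meets every lower ideal. The order of the strands is left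
    free, since the residues 0 and 2 link them differently. *)
Lemma rowmotion_orbits_single (a n : nat) : 0 < a ->
  iter n (move a) (0, 0) = (0, 0) ->
  perm_eq (traject (move a) (0, 0) n) (strand0 a ++ strand1 a ++ strand2 a) ->
  exists2 O, rowmotion_orbits (@circular_fence [:: a; 1; 1; 1]) = [set O]
             & #|O| = 3 * a + 4.
Proof.
move=> ha e hp; set s := traject _ _ _ in hp.
have hs : all (valid a) s by exact: all_valid_traject.
have mem_s c : valid a c -> c \in s.
  by move=> hc; rewrite (perm_mem hp) !mem_cat valid_in_strands.
exists [set J in map (ideal_of a) s]; last first.
  by rewrite card_ideals // ?(perm_uniq hp) ?uniq_strands // (perm_size hp) size_strands.
apply/setP => O; rewrite inE; apply/idP/eqP => [/imsetP[I]|->].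
  rewrite inE => hI ->; have [c hc ->] := lower_idealP _ _ ha hI.
  by apply: rowmotion_orbit_traject => //; apply: mem_s.
rewrite -(rowmotion_orbit_traject _ (0, 0) (0, 0)) ?lower_ideal_orbit //.
exact: mem_s.
Qed.

Lemma homomesic_single (T : finType) (le : rel T) (O : {set {set T}})
    (st : {set {set T}} -> nat) :
  rowmotion_orbits le = [set O] -> homomesic le st.
Proof. by move=> e O1 O2; rewrite e !inE => /eqP -> /eqP ->. Qed.

Lemma eq_half_rat (n p q : nat) : n * 2 = p * q ->
  (n%:R = p%:R * q%:R / 2%:R :> rat)%R.
Proof.
by move=> e; rewrite -GRing.natrM -e GRing.natrM GRing.mulfK.
Qed.

Lemma sum_strand0 (a : nat) : 0 < a -> a %% 3 = 1 ->
  (\sum_(c <- strand0 a) (c.1 + c.2)) * 2 = (a + 2) * (a + 3).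
Proof.
move=> ha hmod; have [_ e2 _ _ _] := move_top ha.
rewrite big_traject hmod addn1 (eq_bigr (fun i : 'I__ => (0 + i) %% 3 + i)).
  have -> : a.+2 = 3 * (a %/ 3).+1 by lia.
  by rewrite sum_residues; nia.
move=> [i hi] _ /=; have [hia|hia] := leqP i a; first by rewrite iter_move00.
(* The extra last entry (2, a+1) still has the form (i mod 3, i), so the sum consists of complete
   blocks of three. *)
have -> : i = a.+1 by lia.
by rewrite iterS iter_move00 // hmod e2 /=; lia.
Qed.

Lemma sum_strand1 (a : nat) : 0 < a -> a %% 3 = 1 ->
  (\sum_(c <- strand1 a) (c.1 + c.2)) * 2 = a * (a + 3).
Proof.
move=> ha hmod; rewrite big_traject hmod addn0 big_ord_recl.
rewrite (eq_bigr (fun i : 'I__ => ((0 + i) %% 3 + i) + 1)); last first.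
  by move=> i _; rewrite lift0 iter_move10 //=; lia.
rewrite big_split sum1_card card_ord /=.
(* The start (1, 0) has been split off; of the [a] remaining terms, 3m form complete blocks and one
   is left over. *)
have [m am] : exists m, a = (3 * m).+1 by exists (a %/ 3); lia.
by have := sum_residues 0 m; rewrite am big_ord_recr /=; nia.
Qed.

Lemma sum_strand2 (a : nat) : 0 < a -> a %% 3 = 1 ->
  (\sum_(c <- strand2 a) (c.1 + c.2)) * 2 = (a + 2) * (a + 3).
Proof.
move=> ha hmod; have [_ _ _ e4 _] := move_top ha.
rewrite big_traject hmod addn1 big_ord_recr.
rewrite (eq_bigr (fun i : 'I__ => ((2 + i) %% 3 + i) + 1)); last first.
  by move=> [i hi] _ /=; rewrite iter_move21 //=; lia.
(* The last entry breaks the pattern, which would give first entry 0, and is therefore summed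
   apart. *)
have -> : iter a (move a) (2, 1) = (1, a.+1).
  case: a ha hmod e4 => // b _ hmod e4.
  by rewrite iterS iter_move21 // -e4; congr (move _ (_, _)); lia.
rewrite big_split sum1_card card_ord /=.
have [m am] : exists m, a = (3 * m).+1 by exists (a %/ 3); lia.
by have := sum_residues 2 m; rewrite am big_ord_recr /=; nia.
Qed.

Theorem theorem8p7 (a : nat) (ha : 1 <= a) :
  (a = 0 %[mod 3] \/ a = 2 %[mod 3] ->
     (exists2 O, rowmotion_orbits (@circular_fence [:: a; 1; 1; 1]) = [set O]
                 & #|O| = 3 * a + 4)
     /\ homomesic (@circular_fence [:: a; 1; 1; 1]) (@chibar _)) /\
  (a = 1 %[mod 3] ->
     exists O1 O2 O3,
       [/\ rowmotion_orbits (@circular_fence [:: a; 1; 1; 1])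
             = [set O1; O2; O3],
           uniq [:: O1; O2; O3],
           [/\ #|O1| = a + 2, #|O2| = a + 1 & #|O3| = a + 1]
         & [/\ ((chibar O1)%:R = (a + 2)%:R * (a + 3)%:R / 2%:R :> rat)%R,
               ((chibar O2)%:R = (a + 2)%:R * (a + 3)%:R / 2%:R :> rat)%R
             & ((chibar O3)%:R = a%:R * (a + 3)%:R / 2%:R :> rat)%R]]).
Proof.
have i0 := iter_strand0 ha; have i1 := iter_strand1 ha; have i2 := iter_strand2 ha.
split=> hmod.
  suff [n e hp] : exists2 n, iter n (move a) (0, 0) = (0, 0) &
      perm_eq (traject (move a) (0, 0) n) (strand0 a ++ strand1 a ++ strand2 a).
    have [O hO cO] := rowmotion_orbits_single _ _ ha e hp.
    by split; [exists O | apply: homomesic_single hO].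
  rewrite /strand0 /strand1 /strand2; case: hmod => hmod.
    (* For residue 0 the cycle runs through [strand0], [strand1], [strand2] in this order; [n0],
       [n1], [n2] are their lengths. *)
    move: (a.+1 + _) (a.+1 + _) (a + _) i0 i1 i2 => n1 n0 n2; rewrite hmod /= => i0 i1 i2.
    exists (n0 + (n1 + n2)); first by rewrite addnC iterD i0 addnC iterD i1.
    by rewrite !trajectD i0 i1.
  (* For residue 2 the order is [strand0], [strand2], [strand1]. *)
  move: (a.+1 + _) (a.+1 + _) (a + _) i0 i1 i2 => n1 n0 n2; rewrite hmod /= => i0 i1 i2.
  exists (n0 + (n2 + n1)); first by rewrite addnC iterD i0 addnC iterD i2.
  by rewrite !trajectD i0 i2 perm_cat2l perm_catC.
(* Each strand now returns to its own start. Only the index of [nth] is rewritten, so the iteration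
   counts remain the lengths in the definitions of the strands. *)
rewrite [X in nth _ _ X]hmod in i0; rewrite [X in nth _ _ X]hmod in i1.
rewrite [X in nth _ _ X]hmod in i2.
pose O s := [set J in map (ideal_of a) s].
have a0 : all (valid a) (strand0 a) by exact: all_valid_traject.
have a1 : all (valid a) (strand1 a) by exact: all_valid_traject.
have a2 : all (valid a) (strand2 a) by exact: all_valid_traject.
have := uniq_strands ha; rewrite !cat_uniq has_cat negb_or.
case/and3P=> u0 /andP[d01 d02] /and3P[u1 d12 u2].
have m0 : (0, 0) \in strand0 a by rewrite /strand0 addSn mem_head.
have m1 : (1, 0) \in strand1 a by rewrite /strand1 addSn mem_head.
have m2 : (2, 1) \in strand2 a by rewrite /strand2 hmod addn1 mem_head.
have o0 c : c \in strand0 a -> _ := rowmotion_orbit_traject a (0, 0) c _ ha isT i0.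
have o1 c : c \in strand1 a -> _ := rowmotion_orbit_traject a (1, 0) c _ ha isT i1.
have o2 c : c \in strand2 a -> _ := rowmotion_orbit_traject a (2, 1) c _ ha isT i2.
(* Disjoint strands give distinct orbits: by injectivity of [ideal_of] on valid states, the ideal of
   a state in [s] cannot come from [s']. *)
have neqO s s' c : c \in s -> all (valid a) s -> all (valid a) s' -> ~~ has (mem s') s ->
    O s != O s'.
  move=> hc hs hs' /hasPn /(_ c hc) hn; apply: contraNneq hn => e.
  have : ideal_of a c \in O s' by rewrite -e inE map_f.
  rewrite inE => /mapP[d hd /ideal_of_inj ed].
  have -> // : c = d.
  by apply: ed; rewrite unfold_in; [apply: (allP hs) | apply: (allP hs')].
(* [strand1] comes last: of the two orbits of size a + 1 it has the smaller sum. *)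
exists (O (strand0 a)), (O (strand2 a)), (O (strand1 a)); split.
- apply/setP => X; rewrite !inE; apply/idP/idP.
    case/imsetP=> I; rewrite inE => /(lower_idealP _ _ ha)[c hc ->] ->.
    case/or3P: (valid_in_strands _ _ ha hc) => h.
    + by rewrite o0 ?eqxx.
    + by rewrite o1 ?eqxx ?orbT.
    + by rewrite o2 ?eqxx ?orbT.
  case/orP=> [/orP[]|] /eqP ->.
  + by rewrite /O -(o0 _ m0) lower_ideal_orbit.
  + by rewrite /O -(o2 _ m2) lower_ideal_orbit.
  + by rewrite /O -(o1 _ m1) lower_ideal_orbit.
- rewrite /= !inE !negb_or andbT -andbA; apply/and3P; split.
  + by rewrite eq_sym (neqO _ _ (2, 1)).
  + by rewrite eq_sym (neqO _ _ (1, 0)).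
  + by rewrite (neqO _ _ (2, 1)).
- split; rewrite /O card_ideals //.
  + by rewrite size_traject hmod /= addn1 addn2.
  + by rewrite size_traject hmod.
  + by rewrite size_traject hmod addn0 addn1.
- by split; apply: eq_half_rat;
    rewrite /O chibar_ideals // ?sum_strand0 ?sum_strand1 ?sum_strand2.
Qed.
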